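(* Let $P$ be a uniformly continuously searchable closeness space with a fixed searcher $\mathcal{E}_P$, let $O$ be a pseudocloseness space, let $M:P\to O$ be uniformly continuous, let $\Omega\in O$ be synthetically constructed from $M$ (i.e. $\Omega=M(k)$ for some $k\in P$), and let $\Psi:O\to O$ be a distortion function. For $\varepsilon\in\mathbb{N}$ and $\Theta\in O$ define $\mathrm{reg}(\varepsilon,M,\Theta):=\mathcal{E}_P\big(p\mapsto C_\varepsilon(M(p),\Theta)\big)$. Then for every $\varepsilon\in\mathbb{N}$, the regressed oracle $\omega:=M(\mathrm{reg}(\varepsilon,M,\Psi(\Omega)))$ is such that if $C_\varepsilon(\Psi(\Omega),\Omega)$ then $C_\varepsilon(\omega,\Omega)$.
   Context: Constructive type theory. $\mathbb{N}_\infty$: decreasing binary sequences; $\underline{n}$: $n$ ones then zeros; $\infty$: all ones; $u\preceq v$ iff $\forall n\,(u_n=1\Rightarrow v_n=1)$; $\min$ pointwise. A closeness space is a type with $c:X\to X\to\mathbb{N}_\infty$ satisfying $c(x,y)=\infty\iff x=y$, symmetry, and $\min(c(x,y),c(y,z))\preceq c(x,z)$; a pseudocloseness space satisfies the same except only $x=y\Rightarrow c(x,y)=\infty$. $C_\varepsilon(x,y)$ means $\underline{\varepsilon}\preceq c(x,y)$. $M$ is uniformly continuous if for each $\varepsilon$ there is $\delta$ with $C_\delta(p_1,p_2)\Rightarrow C_\varepsilon(M(p_1),M(p_2))$. A predicate $p$ on $P$ is decidable if each $p(x)$ is decided, uniformly continuous if there is $\delta$ with $C_\delta(x_1,x_2)\Rightarrow(p(x_1)\Leftrightarrow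 p(x_2))$. A searcher on $P$ is a function $\mathcal{E}_P$ sending each decidable predicate $p$ given with a modulus of uniform continuity to $\mathcal{E}_P(p)\in P$ such that if some $x$ satisfies $p$ then $p(\mathcal{E}_P(p))$; $P$ is uniformly continuously searchable if it has a searcher. *)

(* Defs.v *)
From mathcomp Require Import all_boot.

Set Implicit Arguments.
Unset Strict Implicit.
Unset Printing Implicit Defensive.

(* The sequences are compared with Leibniz equality, so identifying two       *)
(* elements of conat from pointwise equality uses function extensionality and *)
(* proof irrelevance.                                                         *)
Record conat := Conat {
  conat_seq :> nat -> bool;
  conat_decr : forall n, conat_seq n.+1 -> conat_seq n }.

Lemma fin_decr (n : nat) k : k.+1 < n -> k < n.
Proof. exact: ltnW. Qed.

Definition conat_fin (n : nat) : conat := @Conat (fun k => k < n) (@fin_decr n).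

Definition conat_infty : conat := @Conat (fun=> true) (fun=> id).

Definition conat_le (u v : conat) : Prop := forall n, u n -> v n.

Lemma min_decr (u v : conat) n : u n.+1 && v n.+1 -> u n && v n.
Proof. by case/andP=> /conat_decr-> /conat_decr->. Qed.

Definition conat_min (u v : conat) : conat :=
  @Conat (fun n => u n && v n) (@min_decr u v).

Record pseudoclosenessSpace := PseudoclosenessSpace {
  pc_sort :> Type;
  closeness : pc_sort -> pc_sort -> conat;
  closeness_refl : forall x y, x = y -> closeness x y = conat_infty;
  closeness_sym : forall x y, closeness x y = closeness y x;
  closeness_ultra : forall x y z,
    conat_le (conat_min (closeness x y) (closeness y z)) (closeness x z) }.

Record closenessSpace := ClosenessSpace {
  cs_pseudo :> pseudoclosenessSpace;
  closeness_eq : forall x y : cs_pseudo,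
    closeness x y = conat_infty -> x = y }.

Definition close (X : pseudoclosenessSpace) (eps : nat) (x y : X) : Prop :=
  conat_le (conat_fin eps) (closeness x y).

(* The moduli below are data (subset types rather than exists), since a       *)
(* searcher takes a modulus as an argument.                                   *)
Definition unif_continuous (X Y : pseudoclosenessSpace) (f : X -> Y) : Type :=
  forall eps, {delta | forall x1 x2,
    close delta x1 x2 -> close eps (f x1) (f x2)}.

Definition unif_continuous_pred (X : pseudoclosenessSpace) (p : X -> Prop)
    : Type :=
  {delta | forall x1 x2, close delta x1 x2 -> (p x1 <-> p x2)}.

Record ucDecPred (X : pseudoclosenessSpace) := UcDecPred {
  ucd_pred :> X -> Prop;
  ucd_dec : forall x, decidable (ucd_pred x);
  ucd_uc : unif_continuous_pred ucd_pred }.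

Record searcher (X : pseudoclosenessSpace) := Searcher {
  search :> ucDecPred X -> X;
  searchP : forall p : ucDecPred X, (exists x, p x) -> p (search p) }.

Lemma closeP (X : pseudoclosenessSpace) eps (x y : X) :
  reflect (close eps x y) (all (closeness x y) (iota 0 eps)).
Proof.
apply: (iffP allP) => cxy n; last by rewrite mem_iota add0n; apply: cxy.
by move=> ltn; apply: cxy; rewrite mem_iota add0n.
Qed.

Definition close_dec (X : pseudoclosenessSpace) eps (x y : X) :
  decidable (close eps x y) := decP (closeP eps x y).

Lemma close_sym (X : pseudoclosenessSpace) eps (x y : X) :
  close eps x y -> close eps y x.
Proof. by rewrite /close closeness_sym. Qed.

Lemma close_trans (X : pseudoclosenessSpace) eps (x y z : X) :
  close eps x y -> close eps y z -> close eps x z.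
Proof.
move=> cxy cyz n ltn; apply: (closeness_ultra (y := y)).
by rewrite /= cxy // cyz.
Qed.

Section Regression.

Variables (P : closenessSpace) (O : pseudoclosenessSpace).
Variables (M : P -> O) (M_uc : unif_continuous M).

Lemma close_to_modulus eps (Theta : O) (x1 x2 : P) :
  close (sval (M_uc eps)) x1 x2 ->
  close eps (M x1) Theta <-> close eps (M x2) Theta.
Proof.
move=> /(svalP (M_uc eps)) c12; split; last exact: close_trans.
exact/close_trans/close_sym.
Qed.

Definition close_to (eps : nat) (Theta : O) : ucDecPred P :=
  {| ucd_pred := fun p => close eps (M p) Theta;
     ucd_dec := fun p => close_dec eps (M p) Theta;
     ucd_uc := exist _ (sval (M_uc eps)) (@close_to_modulus eps Theta) |}.

Definition reg (E : searcher P) (eps : nat) (Theta : O) : P :=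
  E (close_to eps Theta).

End Regression.

Definition synthetic (P O : Type) (M : P -> O) (Omega : O) : Prop :=
  exists k, Omega = M k.

(* Main.v *)
Require Import Defs.
From mathcomp Require Import all_boot.

Theorem theorem4p37 (P : closenessSpace) (E : searcher P)
  (O : pseudoclosenessSpace) (M : P -> O) (M_uc : unif_continuous M)
  (Omega : O) (Omega_synth : synthetic M Omega) (Psi : O -> O) :
  forall eps : nat,
    let omega := M (reg M_uc E eps (Psi Omega)) in
    close eps (Psi Omega) Omega -> close eps omega Omega.
Proof.
(* The regression only sees the distorted oracle, so closeness to [Omega] is routed through
   [Psi Omega]: it remains to show that [omega] is close to [Psi Omega]. *)
move=> eps omega cPsi; apply: (close_trans _ cPsi).
have [k defOmega] := Omega_synth.
(* This goal is the searched predicate at the searcher's own answer, so any one solution suffices.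
   The true parameter [k] is one: [M k] is [Omega], which [cPsi] puts close to [Psi Omega]. *)
apply: (searchP E (p := close_to M_uc eps (Psi Omega))).
by exists k; rewrite /= -defOmega; apply: close_sym.
Qed.
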